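(* Let $L,R>0$, and let $\mathcal{O}$ be an arbitrary local oracle for the family $\mathcal{F}$ of convex functions on the $L^\infty$-ball $B_\infty(0,R)=[-R,R]^n\subset\mathbb{R}^n$ that are Lipschitz-continuous with Lipschitz constant $L$ in the $L^\infty$ norm. Then both the distributional and the high-probability oracle complexity for finding an $\varepsilon$-minimum are $\Omega\left(n\log\frac{LR}{\varepsilon}\right)$. For bounded-error algorithms with error bound $P_e$, the distributional complexity is $\Omega\left((1-P_e)\,n\log\frac{LR}{\varepsilon}\right)$, and the high-probability complexity is $\Omega\left(n\log\frac{LR}{\varepsilon}\right)$.
   Context: $\log$ is the binary logarithm. For $f:X\to\mathbb{R}$ with $f^*=\min_X f$, an $\varepsilon$-minimum is a point $x\in X$ with $f(x)<f^*+\varepsilon$. An oracle $\mathcal{O}$ for a family $\mathcal{F}$ of functions on $X$ returns for an instance $f\in\mathcal{F}$ and a query $x\in X$ an answer $\mathcal{O}_f(x)$ (from an arbitrary answer set). It is local if $\mathcal{O}_{f_1}(x)=\mathcal{O}_{f_2}(x)$ whenever $f_1,f_2\in\mathcal{F}$ are equal in a neighborhood of $x$. An algorithm accesses the instance only by adaptive oracle queries; it stops and outputs a point of $X$. $T_A(f,\varepsilon)$ is the number of queries of algorithm $A$ on $f$. With $\Delta(\mathcal{F})$ the set of probability distributions on $\mathcal{F}$ and $\mathcal{A}(\mathcal{O})$ the set of $\mathcal{O}$-based algorithms, the distributional complexity is $\sup_{F\in\Delta(\mathcal{F})}\inf_{A\in\mathcal{A}(\mathcal{O})}\mathbb{E}_F[T_A(F,\varepsilon)]$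 and the high-probability complexity is $\sup_{F\in\Delta(\mathcal{F})}\inf_{A\in\mathcal{A}(\mathcal{O})}\sup\{\tau:\mathbb{P}_F[T_A(F,\varepsilon)\ge\tau]=1-o(1)\}$. For bounded-error algorithms with error bound $P_e$, the output need be an $\varepsilon$-minimum only with probability at least $1-P_e$ (over the random instance and any private randomness), and $1-o(1)$ is replaced by $1-P_e-o(1)$. The asymptotic statements mean: there are a universal constant $c>0$ and, for each $n,\varepsilon,L,R$, a distribution on $\mathcal{F}$ such that every algorithm with error bound $P_e$ ($P_e=0$ in the error-free case) satisfies $\mathbb{E}[T]\ge c(1-P_e)n\log\frac{LR}{\varepsilon}$, respectively $\mathbb{P}[T\ge c\,n\log\frac{LR}{\varepsilon}]\ge1-P_e-o(1)$, asymptotically as $n\log\frac{LR}{\varepsilon}\to\infty$ with $LR/\varepsilon$ at least a universal constant and $P_e\in[0,1)$ fixed. *)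

(* Defs.v *)
From HB Require Import structures.
From mathcomp Require Import all_boot all_order all_algebra.
From mathcomp Require Import all_classical all_reals all_analysis.
From mathcomp Require Import measurable_realfun.

Set Implicit Arguments.
Unset Strict Implicit.
Unset Printing Implicit Defensive.

Import Order.TTheory GRing.Theory Num.Theory.
Import numFieldNormedType.Exports.

Local Open Scope classical_set_scope.
Local Open Scope ring_scope.

Definition log2 (R : realType) (x : R) : R := ln x / ln 2.

(* The norm of 'rV[R]_n is the maximum norm, so this is [-rho, rho]^n. *)
Definition box (R : realType) (n : nat) (rho : {posnum R}) : set 'rV[R]_n :=
  [set x | `|x| <= rho%:num].
Arguments box : clear implicits.

(* Functions live on the box itself, as a subtype. [valL_ 0 f] is their
   extension by 0 to the whole space; both conditions below only look at its
   values on the box. *)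
Definition is_convex_lipschitz (R : realType) (n : nat) (L rho : {posnum R})
    (f : box R n rho -> R) : Prop :=
  convex_function (box R n rho) (valL_ 0 f : 'rV[R]_n -> R^o) /\
  L%:num.-lipschitz_(box R n rho) (valL_ 0 f : 'rV[R]_n -> R^o).

Definition instance (R : realType) (n : nat) (L rho : {posnum R}) :=
  {f : box R n rho -> R | is_convex_lipschitz L f}.
Arguments instance {R} n L rho.

Lemma is_convex_lipschitz0 (R : realType) (n : nat) (L rho : {posnum R}) :
  is_convex_lipschitz L (fun _ : box R n rho => 0 : R).
Proof.
have -> : is_convex_lipschitz L (fun _ : box R n rho => 0 : R) =
    (convex_function (box R n rho) (fun=> 0 : R^o) /\
     L%:num.-lipschitz_(box R n rho) (fun=> 0 : R^o)).
  rewrite /is_convex_lipschitz.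
  suff -> : valL_ 0 (fun _ : box R n rho => 0 : R) = (fun=> 0) by [].
  by apply/funext => x /=; set o := (X in oapp _ _ X); case: o.
split.
- by move=> t x y _ _; rewrite convmm.
- move=> [x y] _ /=; rewrite subrr normr0.
  by apply: mulr_ge0; [exact: ge0|exact: normr_ge0].
Qed.

(* Algorithms, oracles and answer sets are arbitrary, so the number of queries
   is an arbitrary function of the instance: distributions on the family are
   taken on the sigma-algebra of all its subsets. *)
HB.instance Definition _ (R : realType) (n : nat) (L rho : {posnum R}) :=
  gen_eqMixin (instance n L rho).
HB.instance Definition _ (R : realType) (n : nat) (L rho : {posnum R}) :=
  gen_choiceMixin (instance n L rho).
HB.instance Definition _ (R : realType) (n : nat) (L rho : {posnum R}) :=
  isPointed.Build (instance n L rho)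
    (exist _ (fun=> 0) (is_convex_lipschitz0 n L rho)).
HB.instance Definition _ (R : realType) (n : nat) (L rho : {posnum R}) :=
  @isMeasurable.Build default_measure_display (instance n L rho)
    discrete_measurable discrete_measurable0 discrete_measurableC
    discrete_measurableU.

Definition is_minimum_up_to (R : realType) (X : Type) (f : X -> R) (eps : R)
    (x : X) : Prop :=
  exists2 z, (forall y, f z <= f y) & f x < f z + eps.

Definition oracle (R : realType) (n : nat) (L rho : {posnum R}) (Ans : Type) :=
  instance n L rho -> box R n rho -> Ans.
Arguments oracle {R} n L rho Ans.

(* Neighborhoods are relative to the box. *)
Definition local_oracle (R : realType) (n : nat) (L rho : {posnum R})
    (Ans : Type) (O : oracle n L rho Ans) : Prop :=
  forall (f1 f2 : instance n L rho) (x : box R n rho),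
    (\forall y \near x, sval f1 y = sval f2 y) -> O f1 x = O f2 x.

(* A deterministic algorithm maps the answers received so far (oldest first)
   either to its next query (inl) or to its output (inr). *)
Definition algorithm (X Ans : Type) := seq Ans -> X + X.

(* The answers received after k steps; constant once an output is produced. *)
Fixpoint transcript (X Ans : Type) (ask : X -> Ans) (A : algorithm X Ans)
    (k : nat) : seq Ans :=
  if k is k'.+1 then
    let h := transcript ask A k' in
    if A h is inl x then rcons h (ask x) else h
  else [::].

Definition outputs_after (X Ans : Type) (ask : X -> Ans) (A : algorithm X Ans)
    (k : nat) (x : X) : Prop :=
  A (transcript ask A k) = inr x.

(* +oo if the algorithm never stops. *)
Definition num_queries (R : realType) (X Ans : Type) (ask : X -> Ans)
    (A : algorithm X Ans) : \bar R :=
  ereal_inf [set (k%:R)%:E | k in [set k | exists x, outputs_after ask A k x]].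
Arguments num_queries R {X Ans} ask A.

(* A run that never stops does not succeed. *)
Definition succeeds (R : realType) (X Ans : Type) (f : X -> R) (ask : X -> Ans)
    (eps : R) (A : algorithm X Ans) : Prop :=
  exists k x, outputs_after ask A k x /\ is_minimum_up_to f eps x.

(* Private randomness: a seed, independent of the instance, selects a
   deterministic algorithm. *)
Record randomized_algorithm (R : realType) (X Ans : Type) := RandomizedAlgorithm {
  seed_display : measure_display;
  seed : measurableType seed_display;
  seed_law : probability seed R;
  run_with : seed -> algorithm X Ans }.

Local Open Scope ereal_scope.

(* Below, "\int[mu]_f seed_law A [set w | E f w]" is the probability of the
   event E over the random instance f and the independent seed w. *)

Definition expected_queries (R : realType) (n : nat) (L rho : {posnum R})
    (Ans : Type) (mu : probability (instance n L rho) R)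
    (O : oracle n L rho Ans)
    (A : randomized_algorithm R (box R n rho) Ans) : \bar R :=
  \int[mu]_f \int[seed_law A]_w num_queries R (O f) (run_with w).

Definition prob_queries_ge (R : realType) (n : nat) (L rho : {posnum R})
    (Ans : Type) (mu : probability (instance n L rho) R)
    (O : oracle n L rho Ans)
    (A : randomized_algorithm R (box R n rho) Ans) (tau : R) : \bar R :=
  \int[mu]_f seed_law A [set w | tau%:E <= num_queries R (O f) (run_with w)].

(* The measurability conditions say that the number of queries and success are
   random variable and event of the seed. *)
Record bounded_error (R : realType) (n : nat) (L rho : {posnum R})
    (Ans : Type) (mu : probability (instance n L rho) R)
    (O : oracle n L rho Ans) (eps Pe : R)
    (A : randomized_algorithm R (box R n rho) Ans) : Prop := BoundedError {
  measurable_num_queries : forall f : instance n L rho,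
    measurable_fun [set: seed A]
      ((fun w => num_queries R (O f) (run_with w)) : seed A -> \bar R);
  measurable_succeeds : forall f : instance n L rho,
    measurable [set w : seed A | succeeds (sval f) (O f) eps (run_with w)];
  prob_succeeds_ge : (1 - Pe)%:E <=
    \int[mu]_f seed_law A [set w | succeeds (sval f) (O f) eps (run_with w)] }.

Definition distributional_complexity (R : realType) (n : nat)
    (L rho : {posnum R}) (Ans : Type) (O : oracle n L rho Ans)
    (eps Pe : R) : \bar R :=
  ereal_sup [set ereal_inf [set v |
      exists2 A, bounded_error mu O eps Pe A & v = expected_queries mu O A]
    | mu in [set: probability (instance n L rho) R]].

(* [eta] stands for the o(1) term. *)
Definition high_probability_complexity (R : realType) (n : nat)
    (L rho : {posnum R}) (Ans : Type) (O : oracle n L rho Ans)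
    (eps Pe eta : R) : \bar R :=
  ereal_sup [set ereal_inf [set v |
      exists2 A, bounded_error mu O eps Pe A &
        v = ereal_sup [set tau%:E | tau in
              [set tau : R | (1 - Pe - eta)%:E <= prob_queries_ge mu O A tau]]]
    | mu in [set: probability (instance n L rho) R]].

(* Main.v *)
Require Import Defs.
From HB Require Import structures.
From mathcomp Require Import all_boot all_order all_algebra.
From mathcomp Require Import all_classical all_reals all_analysis.
From mathcomp Require Import measurable_realfun ring lra zify.

(** The hard instances hide, in each of the n coordinates, a path of length
    D ~ log_64 (L rho / eps) in a binary tree of nested intervals. The function
    is the maximum, over all coordinates and levels, of V-shaped functions of one
    coordinate centered at the intervals on the hidden paths; the slope drops by
    16 and the radius by 4 at each level. An eps-minimum must lie in all the
    innermost intervals and hence reveals all M = n D bits.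

    At a query, a local oracle only sees the V's attaining the maximum. Reveal
    the bits greedily, always taking the one that could produce the largest
    value: with probability 1/2 this bit is wrong, its V attains the maximum and
    hides all that is below. So a query reveals O(1) bits on average, and
    M / 8 queries almost never suffice.

    This fails if several V's attain the maximum simultaneously, which the
    algorithm could enforce (at the origin, say). Therefore each V is shifted by
    a small random amount, uniform among M^3 + 1 values. As long as a V has never
    been active, the run does not depend on its shift, so it is unlikely that its
    first appearance is a tie. *)

Set Implicit Arguments.
Unset Strict Implicit.
Unset Printing Implicit Defensive.

Import Order.TTheory GRing.Theory Num.Theory.
Import numFieldNormedType.Exports.

Local Open Scope ring_scope.

(** * Nested intervals on the line and their V-shaped functions *)

Section NestedIntervals.
Context {R : realFieldType}.
Implicit Types (b : nat -> bool) (x : R).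

Definition center b (d : nat) : R :=
  \sum_(e < d.+1) (if b e then 1 else -1) / 2 / 4 ^+ e.

(* The path [b] selects nested intervals of radius [4 ^- d.+1] around
   [center b d]. At their endpoints [vee] is [64 ^- d / 16]: less than its values
   outside, more than all deeper vees inside. The constant [3 / 16] also makes
   every vee nonpositive at all deeper centers. *)
Definition vee b (d : nat) x : R :=
  `|x - center b d| / 16 ^+ d - 3 / 16 / 64 ^+ d.

Lemma centerS b d :
  center b d.+1 = center b d + (if b d.+1 then 1 else -1) / 2 / 4 ^+ d.+1.
Proof. by rewrite /center big_ord_recr. Qed.

Lemma center_eq b b' d :
  (forall e, (e <= d)%N -> b e = b' e) -> center b d = center b' d.
Proof. by move=> bb'; apply: eq_bigr => e _; rewrite bb' // -ltnS. Qed.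

(** The steps below level [d] form a geometric series with ratio [1 / 4] and first term
    [4 ^- d.+1 / 2]; the right-hand side is its partial sum. *)
Lemma center_tail b d e : (d <= e)%N ->
  `|center b e - center b d| <= 2 / 3 * (4 ^- d.+1 - 4 ^- e.+1).
Proof.
elim: e => [|e IH]; first by rewrite leqn0 => /eqP ->; rewrite !subrr normr0 mulr0.
rewrite leq_eqVlt => /predU1P[->|]; first by rewrite !subrr normr0 mulr0.
move=> /IH; rewrite centerS !exprS !invfM.
have : 0 < (4 ^- e : R) by rewrite invr_gt0 exprn_gt0.
move: (4 ^- e) (4 ^- d) (center b e) (center b d) => p q u v p0.
by case: (b e.+1); rewrite !ler_norml => /andP[? ?]; apply/andP; split; lra.
Qed.

Lemma center_le1 b d : `|center b d| <= 1.
Proof.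
have := center_tail b (leq0n d); rewrite expr1 {2}/center big_ord1 expr0 invr1.
have : 0 < (4 ^- d.+1 : R) by rewrite invr_gt0 exprn_gt0.
move: (4 ^- d.+1) (center b d) => p u p0; rewrite !ler_norml => /andP[].
by case: (b _) => ? ?; apply/andP; split; lra.
Qed.

Lemma center_flip b b' d : (forall e, (e < d)%N -> b e = b' e) ->
  b d != b' d -> `|center b d - center b' d| = 4 ^- d.
Proof.
case: d => [|d] bb' bd.
  rewrite /center !big_ord1 expr0 invr1.
  by case: (b 0%N) (b' 0%N) bd => [] [] // _; rewrite ?opprK;
    [rewrite ger0_norm|rewrite ler0_norm]; lra.
rewrite !centerS (center_eq (b := b) (b' := b')); last by move=> e ed; exact: bb'.
have : 0 < (4 ^- d.+1 : R) by rewrite invr_gt0 exprn_gt0.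
move: (4 ^- d.+1) (center b' d) => p u p0.
by case: (b d.+1) (b' d.+1) bd => [] [] // _;
  [rewrite ger0_norm|rewrite ler0_norm]; lra.
Qed.

Lemma expr64V d : (64 ^- d : R) = 16 ^- d * 4 ^- d.
Proof.
by rewrite -invfM -exprMn; congr (_ ^- _); lra.
Qed.

(** The two centers at level [d] are [4 ^- d] apart, so [x] is at least half of this away from one
    of them, whose steep vee then exceeds the flatter one at level [e]. The margin [2 / 64 ^+ e.+1]
    is room for the random shifts. *)
Lemma vee_dominated b b' d e x : (d < e)%N ->
  (forall e', (e' < d)%N -> b e' = b' e') -> b d != b' d ->
  vee b e x + 2 / 64 ^+ e.+1 <= Num.max (vee b d x) (vee b' d x).
Proof.
move=> de bb' bd; have := center_flip bb' bd.
have := center_tail b (ltnW de).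
rewrite /vee !expr64V.
have [k ->] : exists k, e = (d + k).+1.
  by exists (e - d.+1)%N; rewrite -addSn subnKC.
have p0 : 0 < (4 ^- d : R) by rewrite invr_gt0 exprn_gt0.
have q0 : 0 < (16 ^- d : R) by rewrite invr_gt0 exprn_gt0.
have r0 : 0 < (4 ^- k : R) by rewrite invr_gt0 exprn_gt0.
have s0 : 0 < (16 ^- k : R) by rewrite invr_gt0 exprn_gt0.
have r1 : (4 ^- k : R) <= 1 by rewrite invf_le1 ?exprn_gt0// exprn_ege1//; lra.
have s1 : (16 ^- k : R) <= 1 by rewrite invf_le1 ?exprn_gt0// exprn_ege1//; lra.
rewrite !exprS !exprD !invfM.
move: (4 ^- d) (16 ^- d) (4 ^- k) (16 ^- k) p0 q0 r0 s0 r1 s1 => p q r s p0 q0 r0 s0 r1 s1.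
move: (center b _) (center b d) (center b' d) => u v w uv vw.
have pr : 0 < p * r by exact: mulr_gt0.
have xu : `|x - u| <= `|x - v| + p / 4.
  have -> : x - u = (x - v) - (u - v) by lra.
  apply: le_trans (ler_normB _ _) _; lra.
have xw : p <= `|x - v| + `|x - w|.
  have -> : p = `|(x - v) - (x - w)| by rewrite -vw distrC; congr `|_|; lra.
  exact: ler_normB.
have qs : q * s <= q by rewrite ler_piMr // ltW.
have qs0 : 0 < q * s by exact: mulr_gt0.
have prp : p * r <= p by rewrite ler_piMr // ltW.
have h : `|x - u| * (16^-1 * (q * s)) <= (`|x - v| + p / 4) * (16^-1 * q).
  by apply: ler_pM => //; lra.
have h2 : (q * s) * (p * r) <= q * p by apply: ler_pM => //; lra.
have h3 : 0 < (q * s) * (p * r) by exact: mulr_gt0.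
rewrite le_max; apply/orP.
have [xv|xv] := leP (p / 2) `|x - v|; [left|right].
  have : q * (p / 2) <= q * `|x - v| by rewrite ler_pM2l.
  nra.
have : q * `|x - v| <= q * (p / 2) by rewrite ler_pM2l// ltW.
have : q * (p - `|x - v|) <= q * `|x - w| by rewrite ler_pM2l//; lra.
nra.
Qed.

(** By the tail bound the distance is at most [4 ^- d / 6], and [1 / 6 < 3 / 16]. *)
Lemma vee_center_le0 b d e : (d <= e)%N -> vee b d (center b e) <= 0.
Proof.
move=> /(center_tail b); rewrite /vee expr64V exprS !invfM.
have p0 : 0 < (4 ^- d : R) by rewrite invr_gt0 exprn_gt0.
have q0 : 0 < (16 ^- d : R) by rewrite invr_gt0 exprn_gt0.
have r0 : 0 < (4 ^- e.+1 : R) by rewrite invr_gt0 exprn_gt0.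
move=> h; have : 16 ^- d * `|center b e - center b d| <= 16 ^- d * (4 ^- d / 6).
  by rewrite ler_pM2l//; lra.
have := mulr_gt0 q0 p0; lra.
Qed.

(** Small vees put [x] within [15 / 64 * 4 ^- m] of both innermost centers, whereas the innermost
    centers of different paths are at least [4 ^- m] apart. *)
Lemma vee_small_inj b b' m x :
  vee b m x < 3 / 64 ^+ m.+1 -> vee b' m x < 3 / 64 ^+ m.+1 ->
  forall d, (d <= m)%N -> b d = b' d.
Proof.
rewrite /vee expr64V.
have q0 : 0 < (16 ^- m : R) by rewrite invr_gt0 exprn_gt0.
have small c : `|x - c| / 16 ^+ m - 3 / 16 * (16 ^- m * 4 ^- m) < 3 / 64 ^+ m.+1 ->
    `|x - c| < 15 / 16 * 4 ^- m / 4.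
  rewrite exprS !invfM expr64V => h.
  rewrite -(ltr_pM2r q0); lra.
move=> /small xc /small xc' d.
have ccm : `|center b m - center b' m| < 15 / 32 * 4 ^- m.
  have -> : center b m - center b' m = (x - center b' m) - (x - center b m) by lra.
  by apply: le_lt_trans (ler_normB _ _) _; lra.
elim/ltn_ind: d => d IH dm.
apply/eqP/negPn/negP => bd.
have bb' e : (e < d)%N -> b e = b' e.
  by move=> ed; apply: IH => //; exact: leq_trans (ltnW ed) dm.
have := center_flip bb' bd.
have := center_tail b dm; have := center_tail b' dm.
rewrite !exprS !invfM.
have : 4 ^- m <= (4 ^- d : R).
  by rewrite lef_pV2 ?posrE ?exprn_gt0// ler_eXn2l//; lra.
have : 0 < (4 ^- m : R) by rewrite invr_gt0 exprn_gt0.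
move: (4 ^- m) (4 ^- d) ccm => p q ccm p0 pq h h' ccd.
have : `|center b d - center b' d| <=
  `|center b m - center b' m| + `|center b' m - center b' d| + `|center b m - center b d|.
  have -> : center b d - center b' d = (center b m - center b' m)
    + (center b' m - center b' d) - (center b m - center b d) by lra.
  by apply: le_trans (ler_normB _ _) _; rewrite lerD2r ler_normD.
lra.
Qed.

End NestedIntervals.

(** * Runs of a deterministic algorithm *)

Section Transcripts.
Context {X Ans : Type}.
Implicit Types (ask : X -> Ans) (A : algorithm X Ans).

Lemma transcript_stable ask A j k x :
  outputs_after ask A j x -> transcript ask A (j + k) = transcript ask A j.
Proof.
rewrite /outputs_after => Ax; elim: k => [|k IH]; first by rewrite addn0.
by rewrite addnS /= IH Ax.
Qed.

Lemma outputs_after_leq ask A j k x : (j <= k)%N ->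
  outputs_after ask A j x -> outputs_after ask A k x.
Proof.
move=> /subnKC <- Ax.
by rewrite /outputs_after (transcript_stable _ Ax).
Qed.

Lemma outputs_after_inj ask A j k x y :
  outputs_after ask A j x -> outputs_after ask A k y -> x = y.
Proof.
move=> /(outputs_after_leq (leq_maxl j k)) + /(outputs_after_leq (leq_maxr j k)).
by rewrite /outputs_after => -> [].
Qed.

End Transcripts.

(** * Counting the hidden paths that an algorithm can find, for abstract levels *)

Section HiddenPaths.
Context {R : realDomainType} {I : finType} {m q : nat} {X Ans : Type}.

Local Notation node := (I * 'I_m.+1)%type.
Local Notation bits := {ffun node -> bool}.
Local Notation shifts := {ffun node -> 'I_q.+1}.
Implicit Types (s : bits) (u : shifts) (w : bits * shifts) (k : node) (x : X).

Variables (base : bits -> node -> X -> R) (sh : 'I_q.+1 -> R).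

Definition level w k x : R := base w.1 k x + sh (w.2 k).

Definition active w x : {set node} :=
  [set k | [forall k', level w k' x <= level w k x]].

Variables (ask : bits * shifts -> X -> Ans) (wins : bits * shifts -> X -> Prop).

Hypothesis sh_inj : injective sh.

Hypothesis base_prefix : forall s s' i (d : 'I_m.+1) x,
  (forall e : 'I_m.+1, (e <= d)%N -> s (i, e) = s' (i, e)) ->
  base s (i, d) x = base s' (i, d) x.

Hypothesis level_dominated : forall s s' u i (d e : 'I_m.+1) x, (d <= e)%N ->
  (forall e' : 'I_m.+1, (e' < d)%N -> s (i, e') = s' (i, e')) ->
  s (i, d) != s' (i, d) ->
  level (s, u) (i, e) x <=
    Num.max (level (s, u) (i, d) x) (level (s', u) (i, d) x).

Hypothesis ask_active : forall w w' x (S : {set node}),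
  (forall k, k \in S -> level w k =1 level w' k) ->
  active w x \subset S -> active w' x \subset S -> ask w x = ask w' x.

Hypothesis wins_inj : forall s s' u x,
  wins (s, u) x -> wins (s', u) x -> s = s'.

Variable A : algorithm X Ans.

Local Notation run w j := (transcript (ask w) A j).

Definition fresh_tie w j k : Prop :=
  exists x, [/\ A (run w j) = inl x, k \in active w x,
    forall j' x', (j' < j)%N -> A (run w j') = inl x' -> k \notin active w x' &
    exists2 k', k' != k & k' \in active w x].

(* As long as [k] has not been active, its shift has not influenced the run;
   a tie at the first query where it becomes active therefore determines it. *)
Lemma fresh_tie_shift s u u' j k : (forall k', k' != k -> u k' = u' k') ->
  fresh_tie (s, u) j k -> fresh_tie (s, u') j k -> u = u'.
Proof.
move=> uu' [x [Ax kx kj [k1 k1k k1x]]] [x' [Ax' kx' kj' [k1' k1k' k1x']]].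
have lev k' y : k' != k -> level (s, u) k' y = level (s, u') k' y.
  by move=> k'k; rewrite /level /= uu'.
have runE : forall i, (i <= j)%N -> run (s, u) i = run (s, u') i.
  elim => // i IH ij /=; have IHi := IH (ltnW ij).
  case E : (A (run (s, u) i)) => [y|y]; rewrite -IHi E //.
  congr rcons; apply: (ask_active (S := ~: [set k])).
  - by move=> k'; rewrite !inE => k'k y'; exact: lev.
  - by apply/fintype.subsetP => k'; rewrite finset.in_setC finset.in_set1; apply: contraTneq => ->; exact: kj E.
  - apply/fintype.subsetP => k'; rewrite finset.in_setC finset.in_set1; apply: contraTneq => ->.
    by apply: (kj' _ _ ij); rewrite -IHi.
have xx' : x = x' by move: Ax; rewrite runE // Ax' => -[].
subst x'; move: kx k1x kx' k1x'; rewrite !inE.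
move=> /forallP kx /forallP k1x /forallP kx' /forallP k1x'.
(* For both shifts, the tie makes the level of [k] equal to the maximum of the other levels, which
   are the same for [u] and [u']. *)
have eqk : level (s, u) k x = level (s, u') k x.
  apply/eqP; rewrite eq_le; apply/andP; split.
    by apply: le_trans (k1x k) _; rewrite lev //; exact: kx'.
  by apply: le_trans (k1x' k) _; rewrite -lev //; exact: kx.
apply/ffunP => k'; have [->|/uu' //] := eqVneq k' k.
by move: eqk; rewrite /level /= => /addrI /sh_inj.
Qed.

Lemma leq_card_bigcup (J T : finType) (F : J -> {set T}) :
  (#|(\bigcup_j F j)%SET| <= \sum_j #|F j|)%N.
Proof.
elim/big_ind2 : _ => [|a B b C Ba Cb|//]; first by rewrite cards0.
by apply: leq_trans (leq_card_setU B C).1 _; exact: leq_add.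
Qed.

Definition has_fresh_tie T : {set bits * shifts} :=
  [set w | `[< exists j k, (j < T)%N /\ fresh_tie w j k >]].

Lemma card_has_fresh_tie T :
  (#|has_fresh_tie T| * q.+1 <= #|{: node}| * T * #|{: bits * shifts}|)%N.
Proof.
pose F (p : 'I_T * node) := [set w | `[< fresh_tie w p.1 p.2 >]].
have FE : has_fresh_tie T = (\bigcup_p F p)%SET.
  apply/setP => w; rewrite inE; apply/asboolP/finset.bigcupP.
    move=> [j [k [jT jk]]]; exists (Ordinal jT, k) => //.
    by rewrite inE; exact/asboolP.
  by move=> [[j k] _]; rewrite inE => /asboolP jk; exists j, k.
have Fq p : (#|F p| * q.+1 <= #|{: bits * shifts}|)%N.
  (* Overwriting the shift at [p.2] is injective on pairs of a tied outcome and a new shift: the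
     result shows the new shift, and the tie determines the old one. *)
  pose h (z : (bits * shifts) * 'I_q.+1) : bits * shifts :=
    (z.1.1, [ffun k => if k == p.2 then z.2 else z.1.2 k]).
  have hinj : {in finset.setX (F p) [set: 'I_q.+1] &, injective h}.
    move=> [[s u] a] [[s' u'] a']; rewrite !inE !andbT /=.
    move=> /asboolP tu /asboolP tu' [/= ss' /ffunP uu'].
    have -> : a = a' by have := uu' p.2; rewrite !ffunE eqxx.
    rewrite -{}ss' in tu' *.
    rewrite (fresh_tie_shift _ tu tu') // => k' k'p.
    by have := uu' k'; rewrite !ffunE (negPf k'p).
  by have := card_in_imset hinj; rewrite cardsX cardsT card_ord => <-; exact: max_card.
rewrite FE (leq_trans (leq_mul (leq_card_bigcup F) (leqnn _))) //.
rewrite big_distrl /=.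
apply: (@leq_trans (\sum_(p : 'I_T * node) #|{: bits * shifts}|)).
  by apply: leq_sum => p _; exact: Fq.
by rewrite sum_nat_const card_prod card_ord (mulnC T).
Qed.

Definition wins_by w T : Prop :=
  exists2 x, outputs_after (ask w) A T x & wins w x.

(** [S] will be the set of revealed nodes. Paths are revealed from the top, so that the levels of
    revealed nodes are known functions. *)
Definition prefix_closed (S : {set node}) :=
  forall i (d e : 'I_m.+1), (e <= d)%N -> (i, d) \in S -> (i, e) \in S.

Definition next_node (S : {set node}) k :=
  k \notin S /\ forall e : 'I_m.+1, (e < k.2)%N -> (k.1, e) \in S.

Definition set_bit s k b : bits := [ffun k' => if k' == k then b else s k'].

Lemma level_agree (S : {set node}) s s' u k x : prefix_closed S ->
  {in S, s =1 s'} -> k \in S -> level (s, u) k x = level (s', u) k x.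
Proof.
case: k => i d Scl ss' kS; rewrite /level /=; congr (_ + _).
by apply: base_prefix => e ed; apply: ss'; exact: Scl ed kS.
Qed.

Lemma next_node_exists (S : {set node}) i (e : 'I_m.+1) : (i, e) \notin S ->
  exists d : 'I_m.+1, (d <= e)%N /\ next_node S (i, d).
Proof.
move=> ieS.
case: (@arg_minnP _ e (fun d : 'I_m.+1 => (i, d) \notin S) (@nat_of_ord _)) => // d dS dmin.
exists d; split; first exact: dmin.
by split => //= e' e'd; apply/negPn/negP => /dmin; rewrite leqNgt e'd.
Qed.

Lemma level_set_bit (S : {set node}) s s' u k x b : next_node S k ->
  {in S, s =1 s'} -> s k = b ->
  level (s, u) k x = level (set_bit s' k b, u) k x.
Proof.
case: k => i d [/= kS dS] ss' sk; rewrite /level /=; congr (_ + _).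
apply: base_prefix => e; rewrite ffunE leq_eqVlt => /predU1P[/val_inj ->|ed].
  by rewrite eqxx.
rewrite ifF; first by apply: ss'; exact: dS.
by apply/negP => /eqP[eqd]; move: ed; rewrite eqd ltnn.
Qed.

(** Domination is applied to [s] and its flip at the first unrevealed node of the same coordinate:
    one of the two values of that bit gives a level at least as large. *)
Lemma level_le_next (S : {set node}) s s' u k x v : {in S, s =1 s'} ->
  k \notin S ->
  (forall k' b, next_node S k' -> level (set_bit s' k' b, u) k' x <= v) ->
  level (s, u) k x <= v.
Proof.
case: k => i e ss' /next_node_exists[d [de nd]] le_v.
pose t := set_bit s (i, d) (~~ s (i, d)).
have st (e' : 'I_m.+1) : (e' < d)%N -> s (i, e') = t (i, e').
  move=> e'd; rewrite ffunE ifF //.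
  by apply/negP => /eqP[eqd]; move: e'd; rewrite eqd ltnn.
have := @level_dominated s t u i d e x de st.
rewrite ffunE eqxx => /(_ _)/le_trans; apply; first by case: (s _).
rewrite ge_max; apply/andP; split.
  by rewrite (level_set_bit _ _ nd ss' (erefl _)); exact: le_v.
rewrite (@level_set_bit S t s' u _ x (~~ s (i, d)) nd); first exact: le_v.
  move=> k' k'S; rewrite ffunE ifF; first exact: ss'.
  by apply/negP => /eqP k'E; case: nd; rewrite -k'E k'S.
by rewrite ffunE eqxx.
Qed.

(** Equal transcripts lead to the same output, which wins for one bit string only. *)
Lemma card_winners_output u j h (G : {set bits}) :
  {in G, forall s, run (s, u) j = h} -> {in G, forall s, wins_by (s, u) j} ->
  (#|G| <= 1)%N.
Proof.
move=> Gh Gwin; apply/card_le1P => s sG s'; rewrite inE.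
apply/idP/eqP => [s'G|->//].
have [x + wx] := Gwin _ sG; have [x' + wx'] := Gwin _ s'G.
rewrite /outputs_after Gh// => Ahx'; rewrite Gh// Ahx' => -[xx'].
by subst x'; exact: wins_inj wx' wx.
Qed.

(* The next bit to reveal is one whose wrong value would give the largest
   possible function value at the query. If the bit is wrong, nothing else can
   be learned from the query; hence, with [r] bits unrevealed, the Pascal-like
   recursion [N r T.+1 <= N r.-1 T + N r.-1 T.+1], solved by [(5/4)^r * 4^T]. *)
Lemma card_winners u T j h (S : {set node}) (G : {set bits}) :
  prefix_closed S ->
  {in G &, forall s s', {in S, s =1 s'}} ->
  {in G, forall s, run (s, u) j = h} ->
  {in G, forall s j' x, (j' < j)%N -> A (run (s, u) j') = inl x ->
    active (s, u) x \subset S} ->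
  {in G, forall s, (s, u) \notin has_fresh_tie (j + T)} ->
  {in G, forall s, wins_by (s, u) (j + T)} ->
  (4 ^ #|~: S| * #|G| <= 5 ^ #|~: S| * 4 ^ T)%N.
Proof.
have le1 S' G' T' : (#|G'| <= 1)%N ->
    (4 ^ #|~: S'| * #|G'| <= 5 ^ #|~: S'| * 4 ^ T')%N.
  move=> G1; apply: leq_mul; last exact: leq_trans G1 (expn_gt0 4 _).
  by case: #|_| => // r; rewrite leq_exp2r.
elim: T j h S G => [|T IHT] j h S G.
  by rewrite addn0 => _ _ Gh _ _ Gwin; exact/le1/card_winners_output/Gwin/Gh.
have [r] := ubnP #|~: S|; elim: r => // r IHr in S G *.
move=> Sr Scl Gagree Gh Gact Gfresh Gwin.
have [->|[s0 s0G]] := set_0Vmem G; first by rewrite cards0 muln0.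
case Ah : (A h) => [x|x]; last first.
  apply/le1/(card_winners_output (u := u) (j := j + T.+1) (h := h)) => // s sG.
  by have := @transcript_stable _ _ (ask (s, u)) A j T.+1 x; rewrite /outputs_after Gh// => /(_ Ah).
(* Spending the query: if no active node at [x] lies outside [S'], all strings in [G'] get the same
   answer and the induction on [T] applies. *)
have nextG (G' : {set bits}) S' : G' \subset G -> prefix_closed S' -> S \subset S' ->
    {in G' &, forall s s', {in S', s =1 s'}} ->
    {in G', forall s, active (s, u) x \subset S'} ->
    (4 ^ #|~: S'| * #|G'| <= 5 ^ #|~: S'| * 4 ^ T)%N.
  move=> /fintype.subsetP G'G S'cl SS' G'agree G'act.
  have [->|[s1 s1G]] := set_0Vmem G'; first by rewrite cards0 muln0.
  apply: (IHT j.+1 (rcons h (ask (s1, u) x))) => //.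
  - move=> s sG; rewrite /= Gh ?G'G // Ah; congr rcons.
    apply: (ask_active (S := S')); [|exact: G'act|exact: G'act].
    by move=> k kS y; apply: (level_agree _ _ S'cl) => //; exact: G'agree.
  - move=> s sG j' x'; rewrite ltnS leq_eqVlt => /predU1P[->|j'j].
      by rewrite Gh ?G'G // Ah => -[<-]; exact: G'act.
    by move=> /(Gact _ (G'G _ sG) _ _ j'j)/fintype.subset_trans; apply.
  - by move=> s /G'G; rewrite addSnnS; exact: Gfresh.
  - by move=> s /G'G; rewrite addSnnS; exact: Gwin.
have [/forall_inP Gcl|] := boolP [forall s in G, active (s, u) x \subset S].
  apply: leq_trans (nextG G S _ Scl _ Gagree Gcl) _ => //.
  by rewrite leq_mul2l leq_exp2l// leqnSn orbT.
rewrite negb_forall_in => /exists_inP[s1 s1G /fintype.subsetPn[k1 k1x k1S]].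
have [k [b [nk kb_max]]] : exists k b, next_node S k /\
    forall k' b', next_node S k' ->
      level (set_bit s0 k' b', u) k' x <= level (set_bit s0 k b, u) k x.
  have [d [_ nd]] : exists d : 'I_m.+1, (d <= k1.2)%N /\ next_node S (k1.1, d).
    by apply: next_node_exists; rewrite -surjective_pairing.
  pose P (p : node * bool) := `[< next_node S p.1 >].
  have P0 : P ((k1.1, d), true) by exact/asboolP.
  case: (arg_maxP (fun p => level (set_bit s0 p.1 p.2, u) p.1 x) P0).
  move=> [k b] /asboolP /= nk kmax; exists k, b; split => // k' b' nk'.
  by apply: (kmax (k', b')); exact/asboolP.
set v := level (set_bit s0 k b, u) k x in kb_max.
have notS_le_v s k' : s \in G -> k' \notin S -> level (s, u) k' x <= v.
  by move=> sG k'S; apply: (level_le_next _ k'S kb_max); exact: Gagree.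
(* A revealed node has the same level under [s1], where the unrevealed node [k1] attains the
   maximum; so [v] bounds it too. *)
have le_v s k' : s \in G -> level (s, u) k' x <= v.
  move=> sG; have [k'S|] := boolP (k' \in S); last exact: notS_le_v.
  rewrite (level_agree (s' := s1) _ _ Scl) //; last exact: Gagree.
  apply: le_trans (notS_le_v _ _ s1G k1S).
  by move: k1x; rewrite !finset.inE => /forallP.
pose S' := k |: S; pose B := [set s : bits | s k == b].
have S'cl : prefix_closed S'.
  move=> i d e ed; rewrite !finset.inE => /orP[/eqP kE|idS]; last first.
    by rewrite (Scl _ _ _ ed idS) orbT.
  move: ed; rewrite leq_eqVlt => /predU1P[/val_inj ->|ed]; first by rewrite kE eqxx.
  by case: nk => _ /(_ e); rewrite -kE /= => -> //; rewrite orbT.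
have S'card : #|~: S| = #|~: S'|.+1.
  rewrite (cardsD1 k (~: S)) finset.inE; case: nk => -> _; congr _.+1.
  by apply: eq_card => k'; rewrite !finset.inE negb_or.
(* With bit [b] the node [k] reaches [v] and is active. An active node outside [S'] would be active
   for the first time and tied with [k], which [Gfresh] excludes. *)
have bad : (4 ^ #|~: S'| * #|G :&: B| <= 5 ^ #|~: S'| * 4 ^ T)%N.
  apply: nextG => //; [exact: finset.subsetIl|exact: finset.subsetUr| |].
    move=> s s'; rewrite !finset.inE => /andP[sG /eqP sk] /andP[s'G /eqP s'k] k'.
    by rewrite !finset.inE => /orP[/eqP ->|]; [rewrite sk s'k|exact: Gagree].
  move=> s; rewrite !finset.inE => /andP[sG /eqP sk].
  apply/fintype.subsetP => k' k'x; rewrite !finset.inE.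
  apply/norP => -[k'k k'S]; have := Gfresh _ sG; rewrite finset.inE => /asboolP; apply.
  exists j, k'; split; first by rewrite addnS ltnS leq_addr.
  exists x; split => //; first by rewrite Gh.
    by move=> j' x' j'j /(Gact _ sG _ _ j'j)/fintype.subsetP/(_ k')/contra; exact.
  exists k; first by rewrite eq_sym.
  rewrite finset.inE; apply/forallP => k2.
  rewrite [leRHS](level_set_bit _ _ nk (Gagree _ _ sG s0G) sk).
  exact: le_v.
(* Here the bit at [k] is known to be the negation of [b], and the query is still unspent: this is
   the induction on [r]. *)
have good : (4 ^ #|~: S'| * #|G :\: B| <= 5 ^ #|~: S'| * 4 ^ T.+1)%N.
  have GB s : s \in G :\: B -> s \in G by rewrite finset.inE => /andP[].
  apply: IHr => //.
  - by rewrite -ltnS -S'card.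
  - move=> s s'; rewrite !finset.inE => /andP[sk sG] /andP[s'k s'G] k'.
    rewrite !finset.inE => /orP[/eqP ->|]; last exact: Gagree.
    by move: sk s'k; case: (s k) (s' k) (b) => [] [] [].
  - by move=> s /GB; exact: Gh.
  - move=> s /GB sG j' x' j'j /(Gact _ sG _ _ j'j)/fintype.subset_trans; apply.
    exact: finset.subsetUr.
  - by move=> s /GB; exact: Gfresh.
  - by move=> s /GB; exact: Gwin.
rewrite -(cardsID B G) S'card !expnS.
move: bad good; rewrite expnS.
move: (4 ^ #|_|)%N (5 ^ #|_|)%N (4 ^ T)%N (#|G :&: B|) (#|G :\: B|) => p p' t b1 b2.
rewrite mulnDr -!mulnA (mulnCA p').
lia.
Qed.

(** For each choice of the shifts, [card_winners] is started with nothing revealed; outcomes with a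
    fresh tie are counted separately. *)
Lemma card_winners_total T :
  (4 ^ #|{: node}| * #|[set w | `[< wins_by w T >]]| <=
    (5 ^ #|{: node}| * 4 ^ T) * #|{: shifts}| +
    4 ^ #|{: node}| * #|has_fresh_tie T|)%N.
Proof.
set W := [set w | _].
have WE : (#|W| <= #|W :\: has_fresh_tie T| + #|has_fresh_tie T|)%N.
  by rewrite -(cardsID (has_fresh_tie T) W) addnC leq_add2l subset_leq_card// finset.subsetIr.
rewrite (leq_trans (leq_mul (leqnn _) WE))// mulnDr leq_add2r.
pose G u := [set s | (s, u) \in W :\: has_fresh_tie T].
have -> : #|W :\: has_fresh_tie T| = (\sum_u #|G u|)%N.
  rewrite -sum1_card (eq_bigr (fun u => \sum_(s in G u) 1)%N); last first.
    by move=> u _; rewrite sum1_card.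
  rewrite pair_big_dep /= (reindex (fun p : shifts * bits => (p.2, p.1))) /=; last first.
    by exists (fun p => (p.2, p.1)) => -[].
  by apply: eq_bigl => -[u s] /=; rewrite [in RHS]finset.inE.
rewrite big_distrr /= mulnC -sum_nat_const leq_sum// => u _.
have := @card_winners u T 0 [::] finset.set0 (G u).
rewrite finset.setC0 cardsT; apply => //.
- by move=> i d e _; rewrite finset.inE.
- by move=> s s' _ _ k; rewrite finset.inE.
- by move=> s; rewrite !finset.inE => /andP[].
- by move=> s; rewrite !finset.inE => /andP[_ /asboolP].
Qed.

End HiddenPaths.

Local Open Scope classical_set_scope.
Local Open Scope ring_scope.

(** * The hard convex functions on the cube *)

Section HardInstances.
Context {R : realType} {n m q : nat} (L rho : {posnum R}).

Local Notation node := ('I_n.+1 * 'I_m.+1)%type.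
Local Notation bits := {ffun node -> bool}.
Local Notation shifts := {ffun node -> 'I_q.+1}.
Local Notation cube := (box R n.+1 rho).
Implicit Types (s : bits) (u : shifts) (w : bits * shifts) (k : node).
Implicit Types (x y : 'rV[R]_n.+1) (i : 'I_n.+1).

(** A sequence is what [center] expects; [inord] is exact on the indices up to [m], and these are
    what levels up to [m] read. *)
Definition stream s i : nat -> bool := fun d => s (i, inord d).

Definition base s k x : R := vee (stream s k.1) k.2 (x 0 k.1 / rho%:num).

(** Stays within the margin of [vee_dominated], which is smallest at level [m], so that shifted vees
    still dominate deeper ones. *)
Definition shift (a : 'I_q.+1) : R := 2 / 64 ^+ m.+1 * (a%:R / q.+1%:R).

Local Notation lev := (level base shift).

Definition top w x : node :=
  [arg max_(k > (ord0, ord0)) lev w k x]%O.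

Definition hard w x : R := L%:num * rho%:num * lev w (top w x) x.

Lemma le_top w k x : lev w k x <= lev w (top w x) x.
Proof. by rewrite /top; case: arg_maxP => // k' _; exact. Qed.

Lemma shift_ge0 a : 0 <= shift a.
Proof. by rewrite mulr_ge0 ?divr_ge0 ?exprn_ge0. Qed.

Lemma shift_le a : shift a <= 2 / 64 ^+ m.+1.
Proof.
rewrite -[leRHS]mulr1 ler_wpM2l ?divr_ge0 ?exprn_ge0//.
by rewrite ler_pdivrMr// mul1r ler_nat ltnW.
Qed.

Lemma shift_inj : injective shift.
Proof.
move=> a a' /mulfI; rewrite mulf_neq0 ?invr_eq0 ?expf_neq0// => /(_ isT)/divIf.
by rewrite pnatr_eq0 => /(_ isT)/eqP; rewrite eqr_nat => /eqP/val_inj.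
Qed.

Lemma base_prefix s s' i (d : 'I_m.+1) x :
  (forall e : 'I_m.+1, (e <= d)%N -> s (i, e) = s' (i, e)) ->
  base s (i, d) x = base s' (i, d) x.
Proof.
move=> ss'; rewrite /base /vee /=; congr (`|_ - _| / _ - _).
apply: center_eq => e ed; apply: ss'.
by rewrite inordK// (leq_ltn_trans ed).
Qed.

Lemma base_dominated s s' u i (d e : 'I_m.+1) x : (d <= e)%N ->
  (forall e' : 'I_m.+1, (e' < d)%N -> s (i, e') = s' (i, e')) ->
  s (i, d) != s' (i, d) ->
  lev (s, u) (i, e) x <= Num.max (lev (s, u) (i, d) x) (lev (s', u) (i, d) x).
Proof.
rewrite leq_eqVlt => /predU1P[/val_inj -> _ _|de ss' sd].
  by rewrite le_max lexx.
have bb' e' : (e' < d)%N -> stream s i e' = stream s' i e'.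
  by move=> e'd; apply: ss'; rewrite inordK// (ltn_trans e'd).
have := vee_dominated (x 0 i / rho%:num) de bb'.
rewrite /stream inord_val => /(_ sd); rewrite /level /base /=.
have := shift_le (u (i, e)); have := shift_ge0 (u (i, d)).
have : 2 / 64 ^+ m.+1 <= (2 / 64 ^+ e.+1 : R).
  by rewrite ler_pM2l// lef_pV2 ?posrE ?exprn_gt0// ler_weXn2l ?ler1n.
by rewrite !le_max => ? ? ? /orP[]h; apply/orP; [left|right]; lra.
Qed.

Lemma row_coord_le x i : `|x 0 i| <= `|x|.
Proof.
rewrite [leRHS]mx_normrE; apply: (le_bigmax _ (fun p => `|x p.1 p.2|) (0, i)).
Qed.

Lemma lev_lipschitz w k x y :
  lev w k x - lev w k y <= `|x - y| / rho%:num.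
Proof.
rewrite /level opprD addrACA subrr addr0 /base /vee opprB addrA addrNK -mulrBl.
set c := center _ _; set X := x 0 k.1; set Y := y 0 k.1.
have h : `|X / rho%:num - c| - `|Y / rho%:num - c| <= `|x - y| / rho%:num.
  apply: le_trans (lerB_dist _ _) _.
  rewrite opprB addrA addrNK -mulrBl normrM (ger0_norm (_ : 0 <= rho%:num^-1))//.
  by rewrite ler_pM2r ?invr_gt0// (le_trans _ (row_coord_le _ k.1))// !mxE.
have : `|x - y| / rho%:num * 16 ^- k.2 <= `|x - y| / rho%:num.
  by rewrite ler_piMr ?divr_ge0// invf_le1 ?exprn_gt0// exprn_ege1// ler1n.
by apply: le_trans; rewrite ler_wpM2r ?invr_ge0 ?exprn_ge0.
Qed.

Lemma hardB w x y : hard w x - hard w y <= L%:num * `|x - y|.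
Proof.
rewrite /hard -mulrBr -mulrA ler_pM2l//.
have := le_trans (lerB (lexx (lev w (top w x) x)) (le_top w (top w x) y))
  (lev_lipschitz w (top w x) x y).
by rewrite ler_pdivlMr// mulrC.
Qed.

Lemma lev_convex w k x y (t : R) : 0 <= t <= 1 ->
  lev w k (t *: x + (1 - t) *: y) <= t * lev w k x + (1 - t) * lev w k y.
Proof.
move=> /andP[t0 t1]; rewrite /level /base /vee !mxE.
set c := center _ _; set X := x 0 k.1; set Y := y 0 k.1.
have e0 : 0 <= (16 ^- k.2 : R) by rewrite invr_ge0 exprn_ge0.
have : `|(t * X + (1 - t) * Y) / rho%:num - c| <=
    t * `|X / rho%:num - c| + (1 - t) * `|Y / rho%:num - c|.
  have -> : (t * X + (1 - t) * Y) / rho%:num - c =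
      t * (X / rho%:num - c) + (1 - t) * (Y / rho%:num - c) by ring.
  apply: le_trans (ler_normD _ _) _.
  by rewrite !normrM (ger0_norm t0) (ger0_norm (_ : 0 <= 1 - t)) ?subr_ge0.
move=> /(ler_wpM2r e0); lra.
Qed.

Lemma hard_convex w x y (t : R) : 0 <= t <= 1 ->
  hard w (t *: x + (1 - t) *: y) <= t * hard w x + (1 - t) * hard w y.
Proof.
move=> t01; have /andP[t0 t1] := t01; rewrite /hard.
set z := t *: _ + _.
have c0 : 0 <= L%:num * rho%:num by [].
have t1' : 0 <= 1 - t by rewrite subr_ge0.
have := ler_wpM2l c0 (lev_convex w (top w z) x y t01).
have := ler_wpM2l c0 (ler_wpM2l t0 (le_top w (top w z) x)).
have := ler_wpM2l c0 (ler_wpM2l t1' (le_top w (top w z) y)).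
rewrite -/z; lra.
Qed.

Lemma cube_convex x y (t : R) : 0 <= t <= 1 -> cube x -> cube y ->
  cube (t *: x + (1 - t) *: y).
Proof.
rewrite /box /= => /andP[t0 t1] xc yc; rewrite (le_trans (ler_normD _ _))// !normrZ.
have t1' : 0 <= 1 - t by rewrite subr_ge0.
rewrite (ger0_norm t0) (ger0_norm t1').
by have := ler_wpM2l t0 xc; have := ler_wpM2l t1' yc; lra.
Qed.

Lemma valL_hard w x : cube x -> valL_ 0 (sigL cube (hard w)) x = hard w x.
Proof.
move=> xc; have /= -> := congr1 (fun g => g (hard w) x) (sigLK (A := cube) (0 : R)).
by rewrite /patch mem_set.
Qed.

Lemma sigL_hard_convex_lipschitz w : is_convex_lipschitz L (sigL cube (hard w)).
Proof.
(* Both conditions look at values on the cube only, so the extension by 0 may be replaced with any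
   [g] equal to [hard w] there. *)
suff F (g : 'rV[R]_n.+1 -> R^o) : (forall x, cube x -> g x = hard w x) ->
    convex_function cube g /\ L%:num.-lipschitz_cube g.
  by apply: F => x; exact: valL_hard.
move=> gE; split.
  have G x y (t : R) : 0 <= t <= 1 -> cube x -> cube y ->
      g (t *: x + (1 - t) *: y) <= t * g x + (1 - t) * g y.
    move=> t01 xc yc.
    by rewrite (gE _ (cube_convex t01 xc yc)) (gE _ xc) (gE _ yc); exact: hard_convex.
  move=> t x y; rewrite !inE => xc yc; apply: G xc yc.
  by apply/andP.
move=> [x y] /= [xc yc]; rewrite /self_sub /= (gE _ xc) (gE _ yc).
by rewrite ler_norml hardB andbT lerNl opprB distrC hardB.
Qed.

Definition hard_instance w : instance n.+1 L rho :=
  exist _ (sigL cube (hard w)) (sigL_hard_convex_lipschitz w).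

Definition level_cube (s : bits) k (x : cube) : R := base s k (set_val x).

(** Each of the finitely many inactive nodes is below the maximum at [z] by a gap, which persists
    near [z] by Lipschitz continuity. *)
Lemma near_active w (z : cube) :
  \forall y \near z, top w (set_val y) \in active level_cube shift w z.
Proof.
have near_dist d : 0 < d -> \forall y \near z, `|set_val z - set_val y| < d.
  move=> d0; have h : nbhs z [set y : cube | ball (set_val z) d (set_val y)].
    exact: (@initial_continuous cube 'rV[R]_n.+1 set_val z _ (nbhsx_ballx _ _ d0)).
  by apply: filterS h => y; rewrite /= -ball_normE.
have inactive k : k \notin active level_cube shift w z ->
    \forall y \near z, lev w k (set_val y) < lev w (top w (set_val z)) (set_val y).
  rewrite finset.inE => /forallPn[k' /negP/negP]; rewrite -ltNge => kk'.
  have kz : lev w k (set_val z) < lev w (top w (set_val z)) (set_val z).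
    exact: lt_le_trans kk' (le_top _ _ _).
  set k0 := top w (set_val z) in kz *.
  pose gap := lev w k0 (set_val z) - lev w k (set_val z).
  (* Within this radius both levels change by less than half the gap. *)
  have d0 : 0 < rho%:num * (gap / 2) by rewrite mulr_gt0// divr_gt0// subr_gt0.
  have := near_dist _ d0; apply: filterS => y zy.
  have {}zy : `|set_val z - set_val y| / rho%:num < gap / 2 by rewrite ltr_pdivrMr// mulrC.
  have := lev_lipschitz w k0 (set_val z) (set_val y).
  have := lev_lipschitz w k (set_val y) (set_val z).
  by rewrite distrC; move: zy; rewrite /gap; lra.
have : \forall y \near z, forall k, k \notin active level_cube shift w z ->
    lev w k (set_val y) < lev w (top w (set_val z)) (set_val y).
  apply: (filter_forall (F := nbhs z) (f := fun k (y : cube) => k \notin active level_cube shift w z ->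
    lev w k (set_val y) < lev w (top w (set_val z)) (set_val y))) => k.
  case: (boolP (k \in active level_cube shift w z)) => [_|/inactive h].
    exact: nearW.
  by apply: filterS h.
apply: filterS => y hy; apply/negPn/negP => /hy.
by rewrite ltNge le_top.
Qed.

Section Oracle.
Context {Ans : Type} (O : oracle n.+1 L rho Ans).
Hypothesis O_local : local_oracle O.

(** Near [z] both functions are maxima over nodes of [S], where their levels agree; so the instances
    coincide there and locality applies. *)
Lemma ask_active w w' (z : cube) (S : {set node}) :
  (forall k, k \in S -> level level_cube shift w k =1 level level_cube shift w' k) ->
  active level_cube shift w z \subset S -> active level_cube shift w' z \subset S ->
  O (hard_instance w) z = O (hard_instance w') z.
Proof.
move=> ww' /fintype.subsetP wS /fintype.subsetP w'S; apply: O_local.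
have := near_active w z; have := near_active w' z.
apply: filterS2 => y /w'S yw' /wS yw; rewrite /= /hard; congr (_ * _).
apply/eqP; rewrite eq_le; apply/andP; split.
  have := ww' _ yw y; rewrite /level /level_cube /= => h.
  by rewrite [leLHS]h; exact: le_top.
have := ww' _ yw' y; rewrite /level /level_cube /= => h.
by rewrite -[leLHS]h; exact: le_top.
Qed.

End Oracle.

(** At the point made of the innermost centers every vee is nonpositive, so in units of [L * rho]
    the minimum is at most [2 / 64 ^+ m.+1], the bound on the shifts. An [eps]-minimum has value
    below [3 / 64 ^+ m.+1] and thus determines all paths. *)
Lemma hard_instance_wins_inj s s' u (eps : R) (z : cube) :
  eps <= L%:num * rho%:num / 64 ^+ m.+1 ->
  is_minimum_up_to (sval (hard_instance (s, u))) eps z ->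
  is_minimum_up_to (sval (hard_instance (s', u))) eps z -> s = s'.
Proof.
move=> eps_le.
have small t : is_minimum_up_to (sval (hard_instance (t, u))) eps z ->
    forall i, vee (stream t i) m (set_val z 0 i / rho%:num) < 3 / 64 ^+ m.+1.
  move=> [y ymin zy] i.
  pose c : 'rV[R]_n.+1 := \row_i (rho%:num * center (stream t i) m).
  have cc : cube c.
    rewrite /box /= [leLHS]mx_normrE; apply/bigmax_leP; split => // p _.
    by rewrite mxE normrM ger0_norm// ler_piMr// center_le1.
  have yc : hard (t, u) (set_val y) <= L%:num * rho%:num * (2 / 64 ^+ m.+1).
    apply: le_trans (ymin (SigSub (mem_set cc))) _.
  rewrite /= /hard ler_wpM2l// /level /base mxE mulrAC divff// mul1r.
    by rewrite -[leRHS]add0r lerD ?shift_le// vee_center_le0// -ltnS.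
  have {}zy : hard (t, u) (set_val z) < L%:num * rho%:num * (3 / 64 ^+ m.+1).
    apply: lt_le_trans zy _; move: yc eps_le; rewrite /=; lra.
  move: zy; rewrite /hard ltr_pM2l//; apply: le_lt_trans.
  apply: le_trans (le_top _ (i, inord m) _).
  by rewrite /level /base /= inordK// lerDl shift_ge0.
move=> /small zs /small zs'; apply/ffunP => -[i d].
have := vee_small_inj (zs i) (zs' i) (d := d).
by rewrite /stream inord_val -ltnS ltn_ord => /(_ isT).
Qed.

End HardInstances.

(** * Uniform distributions on finite families *)

Section UniformDistribution.
Context {R : realType} {d : measure_display} {T : measurableType d}.
Context {W : finType} (w0 : W) (F : W -> T).

Let card_gt0 : (0 < #|W|)%N. Proof. by apply/card_gt0P; exists w0. Qed.

(** The average of the Dirac measures at the [F w], counted with multiplicity; [w0] is the default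
    of [nth] and shows that [W] is inhabited. *)
Definition uniform_on : set T -> \bar R :=
  mscale (#|W|%:R^-1)%:nng (msum (fun i => \d_(F (nth w0 (enum W) i))) #|W|).

HB.instance Definition _ := Measure.on uniform_on.

Lemma uniform_on_setT : uniform_on setT = 1%E.
Proof.
rewrite /uniform_on /mscale /= /msum (eq_bigr (fun=> 1%E)); last first.
  by move=> i _; exact: diracT.
by rewrite sumEFin sumr_const card_ord /= -EFinM mulVf// pnatr_eq0 -lt0n.
Qed.

HB.instance Definition _ :=
  @Measure_isProbability.Build _ _ R uniform_on uniform_on_setT.

Lemma integral_uniform_on (g : T -> \bar R) :
  measurable_fun setT g -> (forall t, 0 <= g t)%E ->
  (\int[uniform_on]_t g t = (#|W|%:R^-1)%:E * \sum_w g (F w))%E.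
Proof.
move=> mg g0; rewrite ge0_integral_mscale//; congr (_ * _)%E.
rewrite ge0_integral_measure_sum//.
rewrite (eq_bigr (fun i : 'I__ => g (F (nth w0 (enum W) i)))); last first.
  by move=> i _; rewrite integral_dirac// diracT mul1e.
rewrite -(big_mkord xpredT (fun i => g (F (nth w0 (enum W) i)))) cardE.
by rewrite -(big_nth w0 xpredT (fun w => g (F w))) big_enum.
Qed.

End UniformDistribution.

(** * Numerical estimates *)

Section Counting.
Local Open Scope nat_scope.

(** From [5 ^ 4 * 2 = 1250 <= 1296 = 6 ^ 4]. *)
Lemma expn_5_2_leq t m : 4 * t <= m -> 5 ^ m * 2 ^ t <= 6 ^ m.
Proof.
move=> /subnKC <-; move: (m - _) => r; rewrite (expnD 5) (expnD 6) mulnAC.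
rewrite (expnM 5) (expnM 6) -expnMn; apply: leq_mul.
  by case: t => // t; rewrite leq_exp2r.
by case: r => // r; rewrite leq_exp2r.
Qed.

Lemma muln_3_4_leq m : m * 3 ^ m <= 3 * 4 ^ m.
Proof.
elim: m => // m IH; rewrite !expnS.
have : 3 ^ m <= 4 ^ m by case: (m) => // k; rewrite leq_exp2r.
nia.
Qed.

(** With [t <= m / 8] queries, the bound of [card_winners] is at most a fraction [3 / m] of all
    [2 ^ m] bit strings. *)
Lemma muln_5_4_leq m t : 8 * t <= m -> m * (5 ^ m * 4 ^ t) <= 3 * (4 ^ m * 2 ^ m).
Proof.
move=> tm; have h : 5 ^ m * 4 ^ t <= 6 ^ m.
  have -> : 4 ^ t = 2 ^ (2 * t) by rewrite expnM.
  by apply: expn_5_2_leq; rewrite mulnA.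
apply: leq_trans (leq_mul (leqnn m) h) _.
rewrite (expnMn 2 3) -[4]/(2 * 2) mulnCA [leqRHS](_ : _ = 2 ^ m * (3 * (2 * 2) ^ m)).
  by rewrite leq_mul2l muln_3_4_leq orbT.
by rewrite mulnA mulnC.
Qed.

End Counting.

(** The largest [m] with [64 ^+ m.+1 <= z] has [z < 64 ^+ m.+2], and
    [6 * (m + 2) <= 12 * (m + 1)]. *)
Lemma exists_depth (R : realType) (z : R) : 64 <= z ->
  exists m : nat, 64 ^+ m.+1 <= z /\ log2 z <= 12 * m.+1%:R.
Proof.
move=> z64; have z0 : 0 < z by apply: lt_le_trans z64.
pose P k := 64 ^+ k.+1 <= z.
have exP : exists k, P k by exists 0%N; rewrite /P expr1.
have ubP k : P k -> (k <= Num.truncn z)%N.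
  rewrite /P => Pk; rewrite truncn_ge_nat ?(ltW z0)//; apply: le_trans Pk.
  by rewrite -natrX ler_nat ltnW// (ltn_trans (ltnSn k))// ltn_expl.
case: (ex_maxnP exP ubP) => m Pm m_max; exists m; split => //.
have zlt : z < 64 ^+ m.+2.
  by rewrite ltNge; apply/negP => /m_max; rewrite ltnn.
have ln2 : 0 < ln (2 : R) by rewrite ln_gt0// ltr1n.
rewrite /log2 ler_pdivrMr//.
have : ln z <= ln (64 ^+ m.+2) by rewrite ler_ln ?posrE ?exprn_gt0// ltW.
have -> : (64 : R) = 2 ^+ 6 by rewrite -natrX.
rewrite -exprM lnXn// -(mulr_natl (ln _)) => /le_trans; apply.
rewrite ler_pM2r// -natrM ler_nat; lia.
Qed.

(** * From counting to probability and expectation *)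

Section LowerBound.
Context {R : realType} {n m : nat} {L rho : {posnum R}} {eps : R} {Ans : Type}.
Variable O : oracle n.+1 L rho Ans.
Hypothesis O_local : local_oracle O.
Hypothesis eps_le : eps <= L%:num * rho%:num / 64 ^+ m.+1.

Let M := (n.+1 * m.+1)%N.
(** Cubic, so that fresh ties, at [M] nodes and at most [M] queries, have total probability at most
    [1 / M]. *)
Let q := (M ^ 3)%N.
Local Notation cube := (box R n.+1 rho).
Local Notation node := ('I_n.+1 * 'I_m.+1)%type.
Local Notation outcome := ({ffun node -> bool} * {ffun node -> 'I_q.+1})%type.

Let F (w : outcome) : instance n.+1 L rho := hard_instance L rho w.

Let wins (w : outcome) (x : cube) := is_minimum_up_to (sval (F w)) eps x.

Definition hard_distribution : probability (instance n.+1 L rho) R :=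
  uniform_on (([ffun=> false], [ffun=> ord0]) : outcome) F.

Section Card.
Local Open Scope nat_scope.

(** Of the fraction [4 / M], [3 / M] accounts for wins without a fresh tie and [1 / M] for fresh
    ties. *)
Lemma card_fast_winners (A : algorithm cube Ans) T : 8 * T <= M ->
  M * #|[set w : outcome | `[< wins_by (fun w => O (F w)) wins A w T >]%classic]%SET|
  <= 4 * #|{: outcome}|.
Proof.
move=> TM.
have Mnode : #|{: node}| = M by rewrite card_prod !card_ord.
have hB := @card_has_fresh_tie R 'I_n.+1 m q cube Ans (@level_cube R n m rho) shift
  (fun w => O (F w)) (@shift_inj R m q) (ask_active O_local) A T.
have := @card_winners_total R 'I_n.+1 m q cube Ans (@level_cube R n m rho) shift
  (fun w => O (F w)) wins.
set W := [set w | _]%SET; set B := has_fresh_tie _ _ _ _ _ in hB *.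
move=> /(_ _ _ _ _ _ A T).
rewrite Mnode in hB * => hW.
have {}hW : 4 ^ M * #|W| <= 5 ^ M * 4 ^ T * #|{: {ffun node -> 'I_q.+1}}| + 4 ^ M * #|B|.
  apply: hW.
  - by move=> s s' i d x; exact: base_prefix.
  - by move=> s s' u i d e x; exact: base_dominated.
  - by move=> w w' x S; exact: ask_active.
  - by move=> s s' u x; exact: hard_instance_wins_inj.
have cardO : #|{: outcome}| = 2 ^ M * #|{: {ffun node -> 'I_q.+1}}|.
  by rewrite card_prod card_ffun card_bool Mnode.
have M0 : 0 < M by [].
have MB : M * #|B| <= #|{: outcome}|.
  have : #|B| * q.+1 <= M * M * #|{: outcome}|.
    by apply: leq_trans hB _; rewrite !leq_mul//; lia.
  have qM : M * (M * M) <= q.+1 by rewrite /q !expnS expn0 muln1 leqnSn.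
  move: (#|B|) (#|{: outcome}|) => b o bq.
  rewrite -(@leq_pmul2r (M * M)) ?muln_gt0 ?M0// mulnAC mulnC (mulnC o).
  exact: leq_trans (leq_mul (leqnn b) qM) bq.
have := muln_5_4_leq TM => h54.
rewrite -(@leq_pmul2l (4 ^ M)) ?expn_gt0//.
rewrite mulnCA; apply: leq_trans (leq_mul (leqnn M) hW) _.
rewrite mulnDr [leqRHS](_ : _ = 3 * (4 ^ M * 2 ^ M) * #|{: {ffun node -> 'I_q.+1}}| +
  4 ^ M * #|{: outcome}|); last first.
  by rewrite cardO; lia.
by apply: leq_add; [rewrite mulnA leq_mul|rewrite mulnCA leq_mul].
Qed.

End Card.

(** The sigma-algebra on the family is discrete, so every [g] is measurable. *)
Lemma integral_hard_distribution (g : instance n.+1 L rho -> \bar R) :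
  (forall f, 0 <= g f)%E ->
  (\int[hard_distribution]_f g f =
    (#|{: outcome}|%:R^-1)%:E * \sum_w g (F w))%E.
Proof. by move=> g0; apply: integral_uniform_on => // _ Y _. Qed.

(** Success with fewer than [tau] queries has probability at most [4 / M]: for each seed the
    algorithm is deterministic and [card_fast_winners] applies, and this is integrated over the
    seed. *)
Lemma prob_queries_ge_hard (Pe tau : R) (A : randomized_algorithm R cube Ans) :
  bounded_error hard_distribution O eps Pe A -> tau <= M%:R / 8 ->
  ((1 - Pe - 4 / M%:R)%:E <= prob_queries_ge hard_distribution O A tau)%E.
Proof.
move=> [mq ms ps] tauM.
have M0 : 0 < M%:R :> R by rewrite ltr0n.
pose P := seed_law A; pose N := #|{: outcome}|.
have N0 : 0 < N%:R :> R by rewrite ltr0n; apply/card_gt0P; exists ([ffun=> false], [ffun=> ord0]).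
pose S w := [set x : seed A | succeeds (sval (F w)) (O (F w)) eps (run_with x)].
pose Q w := [set x : seed A | (tau%:E <= num_queries R (O (F w)) (run_with x))%E].
pose E w := S w `\` Q w.
have mQ w : measurable (Q w).
  have := emeasurable_fun_c_infty measurableT (mq (F w)) tau%:E.
  by rewrite setTI.
have mE w : measurable (E w) by apply: measurableD => //; exact: ms.
have sumE_le x : \sum_w \1_(E w) x <= 4 * N%:R / M%:R :> R.
  (* Rounding down loses nothing: a number of queries below [tau <= M / 8] is an integer, hence at
     most [M %/ 8]. *)
  pose T := (M %/ 8)%N.
  have TM : (8 * T <= M)%N by rewrite mulnC leq_trunc_div.
  have := card_fast_winners (run_with x) TM; set W := [set w | _]%SET => hW.
  have : \sum_w \1_(E w) x <= #|W|%:R :> R.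
    rewrite -sum1_card natr_sum [leRHS]big_mkcond /=; apply: ler_sum => w _.
    rewrite indicE; case: (boolP (x \in E w)) => [|_]; last by case: ifP.
    rewrite inE => -[[k [z [zk zmin]]] /negP]; rewrite -ltNge => /ereal_inf_lt.
    move=> [_ [j [z' z'j] <-]]; rewrite lte_fin => jtau.
    rewrite ifT// finset.inE; apply/asboolP.
    exists z => //; rewrite (outputs_after_inj zk z'j).
    apply: outputs_after_leq z'j; rewrite leq_divRL// -(ler_nat R) natrM.
    by have := lt_le_trans jtau tauM; lra.
  move=> /le_trans; apply; rewrite ler_pdivlMr// mulrC -!natrM ler_nat.
  exact: hW.
have sumPE : (\sum_w P (E w) <= (4 * N%:R / M%:R)%:E)%E.
  have -> : (\sum_w P (E w) = \int[P]_x \sum_w (\1_(E w) x)%:E)%E.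
    rewrite ge0_integral_sum//.
    - by apply: eq_bigr => w _; rewrite integral_indic// setIT.
    - by move=> w; apply/measurable_EFinP; exact: measurable_indic.
  apply: (@le_trans _ _ (\int[P]_x cst (4 * N%:R / M%:R)%:E x)%E); last first.
    by rewrite integral_cst// [X in (_ * X)%E]probability_setT mule1.
  apply: ge0_le_integral; [exact: measurableT| | |exact: measurable_cst|].
  - by move=> x _; apply: sume_ge0 => w _; rewrite lee_fin.
  - apply: emeasurable_sum => w; apply/measurable_EFinP; exact: measurable_indic.
  - by move=> x _; rewrite sumEFin lee_fin.
have PS_le w : (P (S w) <= P (Q w) + P (E w))%E.
  apply: le_trans (measureU2 _ (mQ w) (mE w)).
  apply: le_measure; rewrite ?inE//; [exact: ms|exact: measurableU|].
  by move=> x Sx; have [Qx|nQx] := pselect (Q w x); [left|right].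
rewrite EFinB leeBlDr//; apply: le_trans ps _.
rewrite /prob_queries_ge !integral_hard_distribution//.
apply: (@le_trans _ _ ((N%:R^-1)%:E * (\sum_w P (Q w) + \sum_w P (E w)))%E).
  rewrite lee_wpmul2l// -big_split /=; apply: lee_sum => w _; exact: PS_le.
rewrite ge0_muleDr; [|exact: sume_ge0|exact: sume_ge0].
rewrite leeD2l//; apply: le_trans (lee_wpmul2l _ sumPE) _ => //.
rewrite -EFinM lee_fin mulrA (mulrCA _ 4) mulVf ?gt_eqF// mulr1.
by [].
Qed.

Lemma num_queries_ge0 (X : Type) (ask : X -> Ans) (A : algorithm X Ans) :
  (0 <= num_queries R ask A)%E.
Proof. by apply: le_ereal_inf_tmp => _ [k _ <-]; rewrite lee_fin. Qed.

(** Markov's inequality, applied to each outcome and averaged. *)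
Lemma expected_queries_hard (Pe tau : R) (A : randomized_algorithm R cube Ans) :
  bounded_error hard_distribution O eps Pe A -> 0 <= tau ->
  (tau%:E * prob_queries_ge hard_distribution O A tau <=
    expected_queries hard_distribution O A)%E.
Proof.
move=> [mq _ _] tau0; rewrite /prob_queries_ge /expected_queries.
rewrite !integral_hard_distribution//; last first.
  by move=> f; apply: integral_ge0 => x _; exact: num_queries_ge0.
rewrite muleCA lee_wpmul2l// ge0_sume_distrr//; apply: lee_sum => w _.
set Q := [set x | _].
have mQ : measurable Q.
  by have := emeasurable_fun_c_infty measurableT (mq (F w)) tau%:E; rewrite setTI.
rewrite -integral_cst//.
apply: (@le_trans _ _ (\int[seed_law A]_(x in Q) num_queries R (O (F w)) (run_with x))%E).
  apply: ge0_le_integral => //; exact: measurable_funTS.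
apply: ge0_subset_integral => // x _; exact: num_queries_ge0.
Qed.

End LowerBound.

Theorem mainTheorem7 (R : realType) :
  exists (c K : R) (N0 : R -> R) (delta : R -> R -> R),
    [/\ 0 < c, 0 < K,
        (forall Pe : R, 0 <= Pe < 1 -> delta Pe x @[x --> +oo] --> 0) &
    forall (n : nat) (L rho eps : {posnum R}),
      (0 < n)%N -> K <= L%:num * rho%:num / eps%:num ->
      let N : R := n%:R * log2 (L%:num * rho%:num / eps%:num) in
      exists mu : probability (instance n L rho) R,
      forall (Ans : Type) (O : oracle n L rho Ans), local_oracle O ->
      forall Pe : R, 0 <= Pe < 1 ->
      [/\ forall A : randomized_algorithm R (box R n rho) Ans,
            bounded_error mu O eps%:num Pe A ->
            (N0 Pe <= N ->
             ((c * (1 - Pe) * N)%:E <= expected_queries mu O A)%E) /\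
            ((1 - Pe - delta Pe N)%:E <= prob_queries_ge mu O A (c * N))%E,
          N0 Pe <= N ->
            ((c * (1 - Pe) * N)%:E <=
              distributional_complexity O eps%:num Pe)%E &
          ((c * N)%:E <=
            high_probability_complexity O eps%:num Pe (delta Pe N))%E]].
Proof.
(* The bound [N <= 12 * M] turns [M / 8] and [4 / M] into [N / 96] and [48 / N]; [exists_depth] asks
   for 64. Markov's inequality at [N / 96] gives [(N * (1 - Pe) - 48) / 96], at least half of its
   main term once [N] reaches [96 / (1 - Pe)], whence [1 / 192]. *)
exists (1 / 192), 64, (fun Pe => 96 / (1 - Pe)), (fun _ x => 48 / x).
split => //.
  move=> Pe _; rewrite -[X in _ --> X](mulr0 48); apply: cvgMr.
  by apply/gtr0_cvgV0; [exact: nbhs_pinfty_gt|exact: cvg_id].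
case=> // n L rho eps _ z64 N.
have [m [mz zm]] := exists_depth z64.
exists (@hard_distribution R n m L rho) => Ans O O_local Pe /andP[Pe0 Pe1].
have eps_le : eps%:num <= L%:num * rho%:num / 64 ^+ m.+1.
  by rewrite ler_pdivlMr ?exprn_gt0// mulrC -ler_pdivlMr.
pose M : R := (n.+1 * m.+1)%:R.
have N_gt0 : 0 < N.
  rewrite mulr_gt0// divr_gt0 ?ln_gt0 ?ltr1n//.
  by apply: lt_le_trans z64; rewrite ltr1n.
have N_le : N <= 12 * M.
  by rewrite /N /M natrM; have := ler_wpM2l (ler0n R n.+1) zm; lra.
have prob_ge A tau : bounded_error (@hard_distribution R n m L rho) O eps%:num Pe A ->
    tau <= N / 96 ->
    ((1 - Pe - 48 / N)%:E <= prob_queries_ge (@hard_distribution R n m L rho) O A tau)%E.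
  move=> bA tauN; apply: le_trans (prob_queries_ge_hard O_local eps_le bA _).
    rewrite lee_fin lerD2l lerN2 ler_pdivrMr ?ltr0n// mulrAC ler_pdivlMr//.
    by rewrite -/M; lra.
  by rewrite -/M; lra.
have cN : 1 / 192 * N <= N / 96 by lra.
have expected_ge A : bounded_error (@hard_distribution R n m L rho) O eps%:num Pe A ->
    96 / (1 - Pe) <= N ->
    ((1 / 192 * (1 - Pe) * N)%:E <= expected_queries (@hard_distribution R n m L rho) O A)%E.
  move=> bA; rewrite ler_pdivrMr ?subr_gt0// => N_large.
  have N96 : 0 <= N / 96 by rewrite divr_ge0// ltW.
  apply: le_trans (expected_queries_hard bA N96).
  apply: le_trans (lee_wpmul2l _ (prob_ge A (N / 96) bA (lexx _))); last by rewrite lee_fin.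
  rewrite -EFinM lee_fin.
  have -> : N / 96 * (1 - Pe - 48 / N) = (N * (1 - Pe) - 48) / 96.
    by field; rewrite gt_eqF.
  lra.
split.
- by move=> A bA; split; [exact: expected_ge|exact: prob_ge].
- move=> N_large; apply: le_trans (ereal_sup_ubound _); last first.
    by exists (@hard_distribution R n m L rho).
  by apply: le_ereal_inf_tmp => _ [A bA ->]; exact: expected_ge.
- apply: le_trans (ereal_sup_ubound _); last first.
    by exists (@hard_distribution R n m L rho).
  apply: le_ereal_inf_tmp => _ [A bA ->]; apply: ereal_sup_ubound.
  by exists (1 / 192 * N) => //; exact: prob_ge.
Qed.
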